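(* Let $n\ge 1$ and let $(M,\phi,\xi,\eta,g)$ be a $(2n+1)$-dimensional $\beta$-Sasakian manifold. Let $V$ be a constant multiple of $\xi$, i.e. $V=c\,\xi$ with $c\in\mathbb{R}$, and let $\lambda$ be a smooth function on $M$. (1) If $(V,\lambda)$ defines an almost Riemann soliton on $M$, then $M$ is an Einstein manifold and $\lambda=\dfrac{\operatorname{scal}}{2n(2n+1)}$. (2) If $(V,\lambda)$ defines an almost Ricci soliton on $M$, then $M$ is an Einstein manifold and $\lambda=\dfrac{\operatorname{scal}}{2n+1}$.
   Context: Manifolds are smooth and connected. An almost contact metric manifold $(M,\phi,\xi,\eta,g)$ of dimension $2n+1$ is a smooth manifold $M$ with a $(1,1)$-tensor field $\phi$, a vector field $\xi$, a $1$-form $\eta$ and a Riemannian metric $g$ such that $\phi^2=-(\mathrm{Id}-\eta\otimes\xi)$, $\eta(\xi)=1$, $\phi\xi=0$, $\eta\circ\phi=0$, $i_\xi g=\eta$, $g(\phi X,\phi Y)=g(X,Y)-\eta(X)\eta(Y)$ and $g(\phi X,Y)=-g(X,\phi Y)$ for all vector fields $X,Y$. It is an $(\alpha,\beta)$-contact metric manifold if there are smooth functions $\alpha,\beta$ on $M$ such that the Levi-Civita connection $\nabla$ of $g$ satisfies $$(\nabla_X\phi)Y=\alpha[g(\phi X,Y)\xi-\eta(Y)\phi X]+\beta[g(X,Y)\xi-\eta(Y)X]$$ for all vector fields $X,Y$. It is $\beta$-Sasakian if $\alpha=0$ and $\beta$ is a nonzero constant. Conventions: $R(X,Y,Z,W)=g(R(X,Y)Z,W)$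 with $R(X,Y)Z=\nabla_X\nabla_YZ-\nabla_Y\nabla_XZ-\nabla_{[X,Y]}Z$; $\operatorname{Ric}(Y,Z)=\sum_i R(E_i,Y,Z,E_i)$ for an orthonormal frame $\{E_i\}$; $\operatorname{scal}$ is the trace of $\operatorname{Ric}$. The Kulkarni–Nomizu product of two $(0,2)$-tensor fields is $$(T_1\odot T_2)(X,Y,Z,W)=T_1(X,W)T_2(Y,Z)+T_1(Y,Z)T_2(X,W)-T_1(X,Z)T_2(Y,W)-T_1(Y,W)T_2(X,Z).$$ For a vector field $V$ and a smooth function $\lambda$, with $\pounds_V$ the Lie derivative: $(V,\lambda)$ defines an almost Riemann soliton if $\frac12\pounds_Vg\odot g+R=\lambda G$, where $G=\frac12 g\odot g$; it defines an almost Ricci soliton if $\frac12\pounds_Vg+\operatorname{Ric}=\lambda g$. Einstein means $\operatorname{Ric}=c_0\,g$ for a constant $c_0$. *)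

(* Defs.v *)
(* MathComp / MathComp-Analysis, over an arbitrary model R : realType of the
   real numbers. *)
From HB Require Import structures.
From mathcomp Require Import all_boot all_order all_algebra.
From mathcomp Require Import all_classical all_reals all_analysis.

Set Implicit Arguments.
Unset Strict Implicit.
Unset Printing Implicit Defensive.

Import Order.TTheory GRing.Theory Num.Theory.
Import numFieldNormedType.Exports.

Local Open Scope classical_set_scope.
Local Open Scope ring_scope.

Section SmoothOn.
Variables (R : realType) (m : nat).

(* C^k on U, meant for U open: the partial derivatives at a point of U only
   see f near that point, so the values of f outside U are irrelevant. *)
Fixpoint Ck_on (k : nat) (U : set 'rV[R]_m) (f : 'rV[R]_m -> R) : Prop :=
  {in U, continuous f} /\
  match k with
  | 0%N => True
  | k'.+1 => forall i : 'I_m,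
      (forall x, U x -> derivable f x (delta_mx 0 i)) /\
      Ck_on k' U (fun x => 'D_(delta_mx 0 i) f x)
  end.

Definition smooth_on U f := forall k, Ck_on k U f.

End SmoothOn.

(* A homeomorphism from an open set of M onto an open set of R^m; chart_map and
   chart_inv are only meaningful on chart_dom and on its image. *)
Record chart (R : realType) (m : nat) (M : topologicalType) := Chart {
  chart_dom : set M ;
  chart_map : M -> 'rV[R]_m ;
  chart_inv : 'rV[R]_m -> M ;
  chart_dom_open : open chart_dom ;
  chart_cod_open : open (chart_map @` chart_dom) ;
  chart_mapK : {in chart_dom, cancel chart_map chart_inv} ;
  chart_map_cont : {in chart_dom, continuous chart_map} ;
  chart_inv_cont : {in chart_map @` chart_dom, continuous chart_inv}
}.

Record manifold (R : realType) (m : nat) := Manifold {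
  mcarrier :> topologicalType ;
  atlas : set (chart R m mcarrier) ;
  atlas_cover : forall p, exists2 c, atlas c & chart_dom c p ;
  atlas_compat : forall c d, atlas c -> atlas d -> forall j,
    smooth_on (chart_map c @` (chart_dom c `&` chart_dom d))
              (fun x => chart_map d (chart_inv c x) 0 j) ;
  manifold_hausdorff : hausdorff_space mcarrier ;
  manifold_countable : @second_countable mcarrier ;
  manifold_connected : connected [set: mcarrier]
}.

Section SmoothOnTheory.
Variables (R : realType) (m : nat).
Implicit Types (U : set 'rV[R]_m) (f g : 'rV[R]_m -> R).

Lemma eq_on_near U f g x : open U -> (forall x, U x -> f x = g x) -> U x ->
  {near x, f =1 g}.
Proof.
by move=> oU fg Ux; apply: filterS (open_nbhs_nbhs (conj oU Ux)) => y /fg.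
Qed.

Lemma eq_on_continuous U f g : open U -> (forall x, U x -> f x = g x) ->
  {in U, continuous f} -> {in U, continuous g}.
Proof.
move=> oU fg cf x /[dup] xU; rewrite inE => Ux.
have := cf x xU; rewrite /prop_for /continuous_at fg// => h.
apply: cvg_trans h; apply: (@near_eq_cvg _ _ (nbhs x)).
by apply: (eq_on_near oU _ Ux) => y Uy; rewrite fg.
Qed.

Lemma eq_Ck_on k U f g : open U -> (forall x, U x -> f x = g x) ->
  Ck_on k U f -> Ck_on k U g.
Proof.
move=> oU; elim: k f g => [|k IH] f g fg [cf Hf].
  by split => //; exact: eq_on_continuous cf.
split; first exact: eq_on_continuous cf.
move=> i; have [df cdf] := Hf i; split.
  move=> x Ux; apply: near_eq_derivable (df x Ux).
  exact: (eq_on_near oU fg Ux).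
apply: IH cdf => x Ux; apply: near_eq_derive.
by apply: (eq_on_near oU _ Ux) => y Uy; rewrite fg.
Qed.

Lemma Ck_onW k U f : Ck_on k.+1 U f -> Ck_on k U f.
Proof.
elim: k f => [|k IH] f [cf Hf]; first by split.
split => // i; have [df cdf] := Hf i; split => //; exact: IH.
Qed.

Lemma Ck_on_cst k U (a : R) : open U -> Ck_on k U (fun=> a).
Proof.
move=> oU; elim: k a => [|k IH] a.
  by split => // x _; exact: cst_continuous.
split; first by move=> x _; exact: cst_continuous.
move=> i; split; first by move=> x _; exact: derivable_cst.
by apply: eq_Ck_on (IH 0) => // x _; rewrite (derive_cst a).
Qed.

Lemma Ck_onD k U f g : open U ->
  Ck_on k U f -> Ck_on k U g -> Ck_on k U (fun x => f x + g x).
Proof.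
move=> oU; elim: k f g => [|k IH] f g [cf Hf] [cg Hg].
  by split => // x xU; exact: (continuousD (cf x xU) (cg x xU)).
split; first by move=> x xU; exact: (continuousD (cf x xU) (cg x xU)).
move=> i; have [df cdf] := Hf i; have [dg cdg] := Hg i; split.
  by move=> x Ux; apply: (derivableD (df x Ux) (dg x Ux)).
apply: eq_Ck_on (IH _ _ cdf cdg) => // x Ux.
by rewrite -(deriveD (df x Ux) (dg x Ux)).
Qed.

Lemma Ck_onM k U f g : open U ->
  Ck_on k U f -> Ck_on k U g -> Ck_on k U (fun x => f x * g x).
Proof.
move=> oU; elim: k f g => [|k IH] f g /[dup] Cf [cf Hf] /[dup] Cg [cg Hg].
  by split => // x xU; exact: (continuousM (cf x xU) (cg x xU)).
split; first by move=> x xU; exact: (continuousM (cf x xU) (cg x xU)).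
move=> i; have [df cdf] := Hf i; have [dg cdg] := Hg i; split.
  by move=> x Ux; apply: (derivableM (df x Ux) (dg x Ux)).
have := Ck_onD oU (IH _ _ (Ck_onW Cf) cdg) (IH _ _ (Ck_onW Cg) cdf).
apply: eq_Ck_on => // x Ux.
by rewrite (_ : (fun x => f x * g x) = f * g)// (deriveM (df x Ux) (dg x Ux)).
Qed.

End SmoothOnTheory.

Section SmoothFunctions.
Variables (R : realType) (m : nat) (M : manifold R m).

Definition smooth (f : M -> R) : Prop := forall c, @atlas R m M c ->
  smooth_on (chart_map c @` chart_dom c) (fun x => f (chart_inv c x)).

Definition smooth_pred : {pred M -> R} := [pred f | `[< smooth f >]].

Lemma smooth_cst a : smooth (fun=> a).
Proof. by move=> c _ k; apply: Ck_on_cst; exact: chart_cod_open. Qed.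

Lemma smooth_subring : subring_closed smooth_pred.
Proof.
have N (f : M -> R) : smooth f -> smooth (- f).
  move=> sf c cA k; have oc := @chart_cod_open _ _ _ c.
  apply: eq_Ck_on (Ck_onM oc (Ck_on_cst k (-1) oc) (sf c cA k)) => // x _.
  by rewrite mulN1r.
split => [|f g /asboolP sf /asboolP sg|f g /asboolP sf /asboolP sg].
- by apply/asboolP; exact: smooth_cst.
- apply/asboolP => c cA k.
  have := Ck_onD (@chart_cod_open _ _ _ c) (sf c cA k) (N _ sg c cA k).
  by apply: eq_Ck_on => //; exact: chart_cod_open.
- apply/asboolP => c cA k.
  have := Ck_onM (@chart_cod_open _ _ _ c) (sf c cA k) (sg c cA k).
  by apply: eq_Ck_on => //; exact: chart_cod_open.
Qed.

HB.instance Definition _ :=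
  GRing.isSubringClosed.Build (M -> R) smooth_pred smooth_subring.

(* The ring C^oo(M). *)
Record smoothFun := SmoothFun {
  sfun :> M -> R ;
  sfunP : sfun \in smooth_pred
}.
HB.instance Definition _ := [isSub for sfun].
HB.instance Definition _ := [Choice of smoothFun by <:].
HB.instance Definition _ :=
  GRing.SubChoice_isSubComPzRing.Build (M -> R) smooth_pred smoothFun
    smooth_subring.

(* The constant function a. *)
Definition csf (a : R) : smoothFun :=
  SmoothFun (asboolT (smooth_cst a)).

End SmoothFunctions.

Section VectorFields.
Variables (R : realType) (m : nat) (M : manifold R m).
Local Notation C := (smoothFun M).

(* Smooth vector fields are encoded as derivations of the R-algebra C^oo(M), and
   tensor fields as C^oo(M)-multilinear maps on the module of vector fields. *)
Definition derivation (X : C -> C) : Prop :=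
  [/\ forall f g, X (f + g) = X f + X g,
      forall a f, X (csf M a * f) = csf M a * X f &
      forall f g, X (f * g) = X f * g + f * X g].

Record vfield := VField {
  vf_fun :> C -> C ;
  vf_derivation : derivation vf_fun
}.

Lemma vfield_ext (X Y : vfield) : X =1 Y -> X = Y.
Proof.
case: X Y => [X dX] [Y dY] /= /funext eXY; subst Y.
by congr VField; exact: Prop_irrelevance.
Qed.

Lemma vf_zero_derivation : derivation (fun=> 0).
Proof. by split=> *; rewrite ?(addr0, mulr0, mul0r). Qed.

Lemma vf_opp_derivation (X : vfield) : derivation (fun f => - X f).
Proof.
have [XD XZ XM] := vf_derivation X; split=> *.
- by rewrite XD opprD.
- by rewrite XZ mulrN.
- by rewrite XM opprD mulNr mulrN.
Qed.

Lemma vf_add_derivation (X Y : vfield) : derivation (fun f => X f + Y f).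
Proof.
have [XD XZ XM] := vf_derivation X; have [YD YZ YM] := vf_derivation Y.
split=> *.
- by rewrite XD YD addrACA.
- by rewrite XZ YZ mulrDr.
- by rewrite XM YM addrACA mulrDl mulrDr.
Qed.

Lemma vf_scale_derivation (h : C) (X : vfield) : derivation (fun f => h * X f).
Proof.
have [XD XZ XM] := vf_derivation X; split=> *.
- by rewrite XD mulrDr.
- by rewrite XZ mulrCA.
- by rewrite XM mulrDr mulrA mulrCA.
Qed.

Lemma vf_bracket_derivation (X Y : vfield) :
  derivation (fun f => X (Y f) - Y (X f)).
Proof.
have [XD XZ XM] := vf_derivation X; have [YD YZ YM] := vf_derivation Y.
split=> [f g|a f|f g].
- by rewrite YD XD XD YD opprD addrACA.
- by rewrite YZ XZ XZ YZ mulrBr.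
- rewrite YM XD !XM YD !YM mulrBl mulrBr [X in _ - X]addrACA opprD.
  rewrite addrACA !opprD [X in X + _]addrACA subrr addr0.
  by rewrite [X in _ + X]addrACA subrr add0r.
Qed.

HB.instance Definition _ := gen_eqMixin vfield.
HB.instance Definition _ := gen_choiceMixin vfield.

Definition vf_zero := VField vf_zero_derivation.
Definition vf_opp X := VField (vf_opp_derivation X).
Definition vf_add X Y := VField (vf_add_derivation X Y).
Definition vf_scale h X := VField (vf_scale_derivation h X).
Definition bracket X Y := VField (vf_bracket_derivation X Y).

Lemma vf_addA : associative vf_add.
Proof. by move=> X Y Z; apply: vfield_ext => f; exact: addrA. Qed.
Lemma vf_addC : commutative vf_add.
Proof. by move=> X Y; apply: vfield_ext => f; exact: addrC. Qed.
Lemma vf_add0 : left_id vf_zero vf_add.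
Proof. by move=> X; apply: vfield_ext => f; exact: add0r. Qed.
Lemma vf_addN : left_inverse vf_zero vf_opp vf_add.
Proof. by move=> X; apply: vfield_ext => f; exact: addNr. Qed.

HB.instance Definition _ :=
  GRing.isZmodule.Build vfield vf_addA vf_addC vf_add0 vf_addN.

Lemma vf_scaleA h k X : vf_scale h (vf_scale k X) = vf_scale (h * k) X.
Proof. by apply: vfield_ext => f; exact: mulrA. Qed.
Lemma vf_scale1 : left_id 1 vf_scale.
Proof. by move=> X; apply: vfield_ext => f; exact: mul1r. Qed.
Lemma vf_scaleDr : right_distributive vf_scale +%R.
Proof. by move=> h X Y; apply: vfield_ext => f; exact: mulrDr. Qed.
Lemma vf_scaleDl X : {morph vf_scale^~ X : h k / h + k}.
Proof. by move=> h k; apply: vfield_ext => f; exact: mulrDl. Qed.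

HB.instance Definition _ := GRing.Zmodule_isLmodule.Build C vfield
  vf_scaleA vf_scale1 vf_scaleDr vf_scaleDl.

(* The tangent space at p. *)
Definition tangent (p : M) (v : C -> R) : Prop :=
  [/\ forall f g, v (f + g) = v f + v g,
      forall a f, v (csf M a * f) = a * v f &
      forall f g, v (f * g) = v f * g p + f p * v g].

End VectorFields.

Section Riemannian.
Variables (R : realType) (m : nat) (M : manifold R m).
Local Notation C := (smoothFun M).
Local Notation VF := (vfield M).
Implicit Types (f h lambda : C) (X Y Z W V xi : VF) (p : M).
Implicit Types (T : VF -> VF -> C) (g Ric : VF -> VF -> C).

(* metric_ge0 and metric_eq0: at p, g is positive definite on tangent vectors,
   the value of X at p being the derivation f |-> X f p. *)
Record riemannian_metric g : Prop := RiemannianMetric {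
  metric_linear : forall Y, scalar (g ^~ Y) ;
  metric_sym : forall X Y, g X Y = g Y X ;
  metric_ge0 : forall X p, 0 <= g X X p ;
  metric_eq0 : forall X p, g X X p = 0 <-> (forall f, X f p = 0)
}.

(* The last two fields characterise the Levi-Civita connection among affine
   connections, given by the first three. *)
Record levi_civita g (nabla : VF -> VF -> VF) : Prop := LeviCivita {
  nabla_linear : forall Y, linear (nabla ^~ Y) ;
  nabla_add : forall X Y Z, nabla X (Y + Z) = nabla X Y + nabla X Z ;
  nabla_leibniz : forall X f Y, nabla X (f *: Y) = X f *: Y + f *: nabla X Y ;
  nabla_torsion_free : forall X Y, nabla X Y - nabla Y X = bracket X Y ;
  nabla_metric : forall X Y Z,
    X (g Y Z) = g (nabla X Y) Z + g Y (nabla X Z)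
}.

Definition riemann (nabla : VF -> VF -> VF) X Y Z : VF :=
  nabla X (nabla Y Z) - nabla Y (nabla X Z) - nabla (bracket X Y) Z.

Definition riemann4 g nabla X Y Z W : C := g (riemann nabla X Y Z) W.

(* The vector fields E_i, defined on all of M, are at p an orthonormal basis of
   the tangent space. *)
Definition orthonormal_basis_at g p (E : 'I_m -> VF) : Prop :=
  (forall i j, g (E i) (E j) p = (i == j)%:R) /\
  (forall v, tangent p v ->
    exists a : 'I_m -> R, forall f, v f = \sum_i a i * E i f p).

(* Near each point, a (0,2)-tensor field is the contraction
   \sum_i R(E_i, -, -, E_i), resp. a function is the trace
   \sum_i Ric(E_i, E_i), in some local orthonormal frame.  Local frames are
   obtained by restricting vector fields of M, which cutoff functions allow;
   the sums do not depend on the frame, so these predicates determine Ric and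
   scal, which always exist. *)
Definition is_ricci g nabla Ric : Prop :=
  forall p, exists E : 'I_m -> VF, \forall q \near p,
    orthonormal_basis_at g q E /\
    forall Y Z, Ric Y Z q = \sum_i riemann4 g nabla (E i) Y Z (E i) q.

Definition is_scal g Ric (scal : C) : Prop :=
  forall p, exists E : 'I_m -> VF, \forall q \near p,
    orthonormal_basis_at g q E /\ scal q = \sum_i Ric (E i) (E i) q.

Definition lie_metric V g X Y : C :=
  V (g X Y) - g (bracket V X) Y - g X (bracket V Y).

Definition kulkarni_nomizu T1 T2 X Y Z W : C :=
  T1 X W * T2 Y Z + T1 Y Z * T2 X W - T1 X Z * T2 Y W - T1 Y W * T2 X Z.

Definition almost_riemann_soliton g nabla V lambda : Prop :=
  forall X Y Z W,
    kulkarni_nomizu (fun A B => csf M 2^-1 * lie_metric V g A B) g X Y Z W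
      + riemann4 g nabla X Y Z W
    = lambda * (csf M 2^-1 * kulkarni_nomizu g g X Y Z W).

Definition almost_ricci_soliton g Ric V lambda : Prop :=
  forall X Y,
    csf M 2^-1 * lie_metric V g X Y + Ric X Y = lambda * g X Y.

Definition einstein g Ric : Prop :=
  exists c0 : R, forall X Y, Ric X Y = csf M c0 * g X Y.

Record almost_contact_metric (phi : {linear VF -> VF}) (xi : VF)
    (eta : {scalar VF}) g : Prop := AlmostContactMetric {
  acm_metric : riemannian_metric g ;
  acm_phi2 : forall X, phi (phi X) = - (X - eta X *: xi) ;
  acm_eta_xi : eta xi = 1 ;
  acm_phi_xi : phi xi = 0 ;
  acm_eta_phi : forall X, eta (phi X) = 0 ;
  acm_eta : forall X, g xi X = eta X ;
  acm_compat : forall X Y, g (phi X) (phi Y) = g X Y - eta X * eta Y ;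
  acm_skew : forall X Y, g (phi X) Y = - g X (phi Y)
}.

(* The structure equation of an (alpha, beta)-contact metric manifold, where
   (nabla_X phi) Y = nabla_X (phi Y) - phi (nabla_X Y). *)
Definition alpha_beta_contact (phi : {linear VF -> VF}) (xi : VF)
    (eta : {scalar VF}) g nabla (alpha beta : C) : Prop :=
  forall X Y, nabla X (phi Y) - phi (nabla X Y) =
    alpha *: (g (phi X) Y *: xi - eta Y *: phi X) +
    beta *: (g X Y *: xi - eta Y *: X).

Definition beta_sasakian phi xi eta g nabla (b : R) : Prop :=
  b != 0 /\ alpha_beta_contact phi xi eta g nabla 0 (csf M b).

End Riemannian.

(* Main.v *)
Require Import Defs.
From HB Require Import structures.
From mathcomp Require Import all_boot all_order all_algebra.
From mathcomp Require Import all_classical all_reals all_analysis.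
From mathcomp Require Import ring lra.
Import Order.TTheory GRing.Theory Num.Theory.
Local Open Scope ring_scope.

(** The Reeb field of a beta-Sasakian manifold is Killing: putting [Y = xi] in
    the structure equation and applying [phi] gives
    [nabla X xi = - beta phi X], and [phi] is skew for [g]
    ([nabla_reeb], [lie_metric_reeb]).  Hence a constant multiple of [xi]
    contributes nothing to either soliton equation, which become
    [R = lambda G], of Ricci contraction [Ric = 2n lambda g], and
    [Ric = lambda g].

    The function [lambda] is constant because the direction [xi] determines
    it at each point.  Differentiating [nabla X xi = - beta phi X] once more
    gives [R(X, Y) xi = beta^2 (eta(Y) X - eta(X) Y)] ([riemann_reeb]), so
    that [Ric(xi, xi) = 2n beta^2] on every beta-Sasakian manifold
    ([ricci_reeb]).  Since [g(xi, xi) = 1], comparing with the Ricci tensor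
    of the soliton equation on [(xi, xi)] yields [lambda = beta^2] in the
    Riemann case and [lambda = 2n beta^2] in the Ricci case.  The formulas in
    terms of [scal] are then obtained by taking a trace
    ([scal_proportional]). *)

(** * Smooth functions and their values *)

Section SmoothFunctionValues.
Set Implicit Arguments.
Variables (R : realType) (m : nat) (M : manifold R m).
Implicit Types (f h : smoothFun M) (X Y : vfield M) (p : M).

Lemma sf_ext f h : (forall p, f p = h p) -> f = h.
Proof. by move=> e; apply: val_inj; apply/funext. Qed.

Lemma sf0E p : (0 : smoothFun M) p = 0. Proof. by []. Qed.
Lemma sf1E p : (1 : smoothFun M) p = 1. Proof. by []. Qed.
Lemma sfDE f h p : (f + h) p = f p + h p. Proof. by []. Qed.
Lemma sfNE f p : (- f) p = - f p. Proof. by []. Qed.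
Lemma sfME f h p : (f * h) p = f p * h p. Proof. by []. Qed.
Lemma csfE a p : csf M a p = a. Proof. by []. Qed.

Lemma sf_sumE (I : Type) (r : seq I) (F : I -> smoothFun M) p :
  (\sum_(i <- r) F i) p = \sum_(i <- r) F i p.
Proof. by apply: (big_morph (fun f : smoothFun M => f p)). Qed.

Definition sfE := (sf0E, sf1E, sfDE, sfNE, sfME, csfE, sf_sumE).

Lemma vf_csf X a : X (csf M a) = 0.
Proof.
have [_ XZ XM] := vf_derivation X.
have X1 : X 1 = 0.
  by have /eqP := XM 1 1; rewrite !mulr1 mul1r -subr_eq0 opprD addNKr oppr_eq0
    => /eqP.
by rewrite -[csf M a]mulr1 XZ X1 mulr0.
Qed.

Lemma vf_tangent X p : tangent p (fun f => X f p).
Proof.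
by have [XD XZ XM] := vf_derivation X; split=> *; rewrite ?(XD, XZ, XM) !sfE.
Qed.

Lemma vfBE X Y f : (X - Y) f = X f - Y f. Proof. by []. Qed.

Lemma vf_sumE (I : Type) (r : seq I) (F : I -> vfield M) f :
  (\sum_(i <- r) F i) f = \sum_(i <- r) F i f.
Proof. by apply: (big_morph (fun X : vfield M => X f)). Qed.

End SmoothFunctionValues.

(** * Metrics, orthonormal frames and traces *)

Section Metric.
Set Implicit Arguments.
Variables (R : realType) (m : nat) (M : manifold R m).
Variable g : vfield M -> vfield M -> smoothFun M.
Hypothesis hg : riemannian_metric g.
Implicit Types (X Y Z W : vfield M) (p : M) (f : smoothFun M).

Lemma metricDl X Y Z : g (X + Y) Z = g X Z + g Y Z.
Proof. by have := metric_linear hg Z 1 X Y; rewrite scale1r => ->;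
  rewrite /= mul1r. Qed.

Lemma metric0l Z : g 0 Z = 0.
Proof. by apply: (addrI (g 0 Z)); rewrite -metricDl !addr0. Qed.

Lemma metricZl f X Z : g (f *: X) Z = f * g X Z.
Proof. by have := metric_linear hg Z f X 0; rewrite !addr0 => ->;
  rewrite metric0l addr0. Qed.

Lemma metricNl X Z : g (- X) Z = - g X Z.
Proof. by rewrite -scaleN1r metricZl mulN1r. Qed.

Lemma metricBl X Y Z : g (X - Y) Z = g X Z - g Y Z.
Proof. by rewrite metricDl metricNl. Qed.

Lemma metricC X Y : g X Y = g Y X.
Proof. exact: Defs.metric_sym. Qed.

Lemma metricDr X Y Z : g X (Y + Z) = g X Y + g X Z.
Proof. by rewrite metricC metricDl !(metricC X). Qed.

Lemma metricZr f X Z : g X (f *: Z) = f * g X Z.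
Proof. by rewrite metricC metricZl (metricC X). Qed.

Lemma metric_suml (I : Type) (r : seq I) (F : I -> vfield M) Z :
  g (\sum_(i <- r) F i) Z = \sum_(i <- r) g (F i) Z.
Proof.
apply: (big_morph (g^~ Z)); last exact: metric0l.
by move=> X Y; exact: metricDl.
Qed.

(** The metric is given on global vector fields; this is what makes it
    descend to the tangent space at [p].  It is the degenerate case of the
    Cauchy-Schwarz inequality: [g(Z, Z) + 2 t g(X, Z)] is nonnegative at [p]
    for all real [t]. *)
Lemma metric_null X Z p : (forall f, X f p = 0) -> g X Z p = 0.
Proof.
move=> /(metric_eq0 hg X p).2 gX0; apply/eqP/negP => /negP a0.
(* This t is where the affine function of t takes the value -1. *)
pose a := g X Z p; pose t := - (g Z Z p + 1) / (2 * a).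
have := metric_ge0 hg (csf M t *: X + Z) p.
rewrite !(metricDl, metricDr, metricZl, metricZr) (metricC Z X) !sfE gX0.
rewrite -/a.
rewrite [X in 0 <= X](_ : _ = -1); last by rewrite /t; field.
by rewrite oppr_ge0 ler10.
Qed.

(** The vector fields [Y] and [\sum_i a i *: E i], with constant [a i], agree
    at [p] only; [metric_null] turns this into an equality of products. *)
Lemma metric_parseval p (E : 'I_m -> vfield M) Y Z :
  orthonormal_basis_at g p E ->
  g Y Z p = \sum_i g (E i) Y p * g (E i) Z p.
Proof.
move=> [Eon Espan]; have [a Ya] := Espan _ (vf_tangent Y p).
have expand W : g Y W p = \sum_i a i * g (E i) W p.
  have : g (Y - \sum_i csf M (a i) *: E i) W p = 0.
    apply: metric_null => f; rewrite vfBE vf_sumE !sfE Ya.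
    exact: subrr.
  rewrite metricBl metric_suml !sfE => /subr0_eq ->.
  by apply: eq_bigr => i _; rewrite metricZl !sfE.
rewrite expand; apply: eq_bigr => i _; congr (_ * _).
rewrite metricC expand (bigD1 i) //= big1 ?addr0 => [|j ji].
  by rewrite Eon eqxx mulr1.
by rewrite Eon (negPf ji) mulr0.
Qed.

(** Tracing over [X] at [p], the first term gives [m g(Y, Z)] and the second,
    by Parseval, [g(Y, Z)].  The hypothesis concerns one pair [Y], [Z], so
    that it covers a curvature tensor proportional to [G] as well as the
    Reeb direction of a Sasakian manifold, where only the pair [(xi, xi)]
    has this form. *)
Lemma ricci_sectional nabla Ric (k : smoothFun M) Y Z p :
  is_ricci g nabla Ric ->
  (forall X, riemann4 g nabla X Y Z X = k * (g X X * g Y Z - g X Y * g X Z)) ->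
  Ric Y Z p = (m%:R - 1) * k p * g Y Z p.
Proof.
move=> hRic hR; have [E /nbhs_singleton [Eb ->]] := hRic p.
under eq_bigr => i _ do rewrite hR !sfE (Eb.1 i i) eqxx mul1r.
rewrite -mulr_sumr big_split /= sumrN -metric_parseval //.
by rewrite sumr_const card_ord -mulr_natl; ring.
Qed.

Lemma scal_proportional Ric (scal k : smoothFun M) p :
  is_scal g Ric scal -> (forall X Y, Ric X Y = k * g X Y) ->
  scal p = m%:R * k p.
Proof.
move=> hscal hk; have [E /nbhs_singleton [Eb ->]] := hscal p.
under eq_bigr => i _ do rewrite hk !sfE (Eb.1 i i) eqxx mulr1.
by rewrite sumr_const card_ord mulr_natl.
Qed.

End Metric.

(** * The Reeb field of a beta-Sasakian manifold *)

Section Sasakian.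
Set Implicit Arguments.
Variables (R : realType) (m : nat) (M : manifold R m).
Variables (phi : {linear vfield M -> vfield M}) (xi : vfield M).
Variables (eta : {scalar vfield M}) (g : vfield M -> vfield M -> smoothFun M).
Variables (nabla : vfield M -> vfield M -> vfield M) (b : R).
Hypothesis hM : almost_contact_metric phi xi eta g.
Hypothesis hnabla : levi_civita g nabla.
Hypothesis hb : alpha_beta_contact phi xi eta g nabla 0 (csf M b).
Implicit Types (X Y Z W : vfield M) (p : M) (f : smoothFun M).

Let hg := acm_metric hM.

Lemma metric_reeb : g xi xi = 1.
Proof. by rewrite (acm_eta hM) (acm_eta_xi hM). Qed.

Lemma nabla_csf X a Y : nabla X (csf M a *: Y) = csf M a *: nabla X Y.
Proof. by rewrite (nabla_leibniz hnabla) vf_csf scale0r add0r. Qed.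

Lemma nabla_phi X Y :
  nabla X (phi Y) = phi (nabla X Y) + csf M b *: (g X Y *: xi - eta Y *: X).
Proof. by have := hb X Y; rewrite scale0r add0r => <-; rewrite addrC subrK. Qed.

(** The Reeb field has constant length. *)
Lemma eta_nabla_reeb X : eta (nabla X xi) = 0.
Proof.
have := nabla_metric hnabla X xi xi; rewrite metric_reeb.
rewrite (metricC hg _ xi) !(acm_eta hM) (_ : 1 = csf M 1); last exact: sf_ext.
rewrite vf_csf => e; apply: sf_ext => p.
have : (0 : smoothFun M) p = (eta (nabla X xi) + eta (nabla X xi)) p.
  by rewrite e.
by rewrite !sfE; lra.
Qed.

(** At [Y = xi] the structure equation reads
    [- phi (nabla X xi) = b (eta X xi - X)].  Applying [phi] recovers
    [nabla X xi] up to its component along [xi], which vanishes. *)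
Lemma nabla_reeb X : nabla X xi = csf M (- b) *: phi X.
Proof.
have := nabla_phi X xi; rewrite (acm_phi_xi hM) (acm_eta_xi hM) scale1r.
have -> : nabla X 0 = 0.
  by apply: (addrI (nabla X 0)); rewrite -(nabla_add hnabla) !addr0.
move/(congr1 phi); rewrite linear0 linearD linearZ linearB linearZ /=.
rewrite (acm_phi2 hM (nabla X xi)) eta_nabla_reeb // (acm_phi_xi hM).
rewrite !(scaler0, scale0r, subr0, sub0r) => /eqP.
rewrite eq_sym addrC subr_eq0 scalerN -scaleNr => /eqP <-.
by congr (_ *: _); apply: sf_ext => p; rewrite !sfE.
Qed.

(** [nabla xi] is a multiple of [phi], which is skew: the Reeb field is
    Killing. *)
Lemma lie_metric_reeb c X Y : lie_metric (csf M c *: xi) g X Y = 0.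
Proof.
have nabla_bracket Z W : bracket Z W = nabla Z W - nabla W Z.
  by rewrite (nabla_torsion_free hnabla).
rewrite /lie_metric (nabla_metric hnabla) !nabla_bracket !nabla_csf !nabla_reeb.
rewrite !(metricBl hg) (metricC hg X (_ - _)) !(metricBl hg) !(metricZl hg).
rewrite (metricC hg (nabla _ Y) X) (metricC hg (phi Y) X).
by rewrite (acm_skew hM X Y); ring.
Qed.

(** By [nabla_reeb], [R(X, Y) xi] is [- b] times the antisymmetrization of
    [(nabla X phi) Y]; the bracket term absorbs the derivatives of [X] and
    [Y], and the structure equation gives the rest. *)
Lemma riemann_reeb X Y :
  riemann nabla X Y xi = csf M (b ^+ 2) *: (eta Y *: X - eta X *: Y).
Proof.
rewrite /riemann !nabla_reeb !nabla_csf !nabla_phi.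
rewrite -(nabla_torsion_free hnabla) (linearB phi) (metricC hg Y X) -!scalerBr.
have drop_common (x y z t : vfield M) : x + y - (z + t) - (x - z) = y - t.
  by rewrite [- (z + t)]opprD [x + y + _]addrACA [LHS]addrC addKr.
have reverse (w x y : vfield M) : w - x - (w - y) = - (x - y).
  by rewrite !opprB [LHS]addrC addrA subrK.
rewrite drop_common -scalerBr reverse scalerN -scaleNr scalerA.
by congr (_ *: _); apply: sf_ext => p; rewrite !sfE; ring.
Qed.

Lemma ricci_reeb Ric p : is_ricci g nabla Ric ->
  Ric xi xi p = (m%:R - 1) * b ^+ 2.
Proof.
move=> hRic.
rewrite (@ricci_sectional _ _ _ _ hg _ _ (csf M (b ^+ 2)) _ _ _ hRic).
  by rewrite metric_reeb !sfE mulr1.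
move=> X; rewrite /riemann4 riemann_reeb !(metricZl hg, metricBl hg).
by rewrite metric_reeb !(metricC hg X xi) (acm_eta hM) (acm_eta_xi hM); ring.
Qed.

End Sasakian.

Theorem mainTheorem1 (R : realType) (n : nat) (M : manifold R (2 * n).+1)
  (phi : {linear vfield M -> vfield M}) (xi : vfield M)
  (eta : {scalar vfield M}) (g : vfield M -> vfield M -> smoothFun M)
  (nabla : vfield M -> vfield M -> vfield M)
  (Ric : vfield M -> vfield M -> smoothFun M) (scal : smoothFun M)
  (beta c : R) (V : vfield M) (lambda : smoothFun M)
  (hn : (1 <= n)%N)
  (hM : almost_contact_metric phi xi eta g)
  (hnabla : levi_civita g nabla)
  (hbeta : beta_sasakian phi xi eta g nabla beta)
  (hRic : is_ricci g nabla Ric)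
  (hscal : is_scal g Ric scal)
  (hV : V = csf M c *: xi) :
  (almost_riemann_soliton g nabla V lambda ->
     einstein g Ric /\
     forall p : M, lambda p = scal p / (2 * n * (2 * n + 1))%N%:R) /\
  (almost_ricci_soliton g Ric V lambda ->
     einstein g Ric /\
     forall p : M, lambda p = scal p / (2 * n + 1)%N%:R).
Proof.
have hg := acm_metric hM; have [_ hb] := hbeta.
have Ric_xi p := ricci_reeb hM hnabla hb p hRic.
have g_xi : g xi xi = 1 by exact: metric_reeb hM.
have lieV X Y : lie_metric V g X Y = 0.
  by rewrite hV (lie_metric_reeb hM hnabla hb).
have n0 : (2 * n)%:R != 0 :> R by rewrite pnatr_eq0 -lt0n muln_gt0.
have n1 : (2 * n + 1)%:R != 0 :> R by rewrite pnatr_eq0 addn1.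
have dimE : (2 * n).+1%:R - 1 = (2 * n)%:R :> R by rewrite -natr1 addrK.
have einstein_of (k : smoothFun M) : (forall X Y, Ric X Y = k * g X Y) ->
    einstein g Ric /\ forall p, scal p = (2 * n + 1)%:R * k p.
  move=> hk; split; last first.
    by move=> p; rewrite (scal_proportional p hscal hk) addn1.
  (* Evaluating Ric = k g on (xi, xi) identifies k with this constant. *)
  exists ((2 * n)%:R * beta ^+ 2) => X Y; rewrite hk; congr (_ * _).
  apply: sf_ext => p; have := Ric_xi p.
  by rewrite hk g_xi mulr1 dimE.
split=> soliton.
- have RicE X Y : Ric X Y = csf M (2 * n)%:R * lambda * g X Y.
    apply: sf_ext => p; rewrite !sfE -dimE.
    apply: (ricci_sectional hg X Y p hRic) => Z.
    have := soliton Z X Y Z; rewrite /kulkarni_nomizu !lieV.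
    rewrite !(mulr0, mul0r, addr0, subr0) add0r => ->.
    by rewrite (metricC hg X Z); apply: sf_ext => q; rewrite !sfE; field.
  have [ein scalE] := einstein_of _ RicE; split => // p.
  rewrite scalE !sfE mulrA -natrM [(_ * (2 * n))%N]mulnC [RHS]mulrC mulKf //.
  by rewrite natrM mulf_neq0.
- have RicE X Y : Ric X Y = lambda * g X Y.
    by rewrite -soliton lieV mulr0 add0r.
  have [ein scalE] := einstein_of _ RicE; split => // p.
  by rewrite scalE mulrC mulKf.
Qed.
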